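(* Let $\mathcal{T}=(\mathcal{V},\mathcal{E})$ be a finite tree with geodesic distance $\mathcal{S}$, and let $m\ge 1$ be an integer. Let $\mathcal{T}^{\odot}$ be the $m$-vertex-operation tree of $\mathcal{T}$. Then the geodesic distance $\mathcal{S}^{\odot}$ of $\mathcal{T}^{\odot}$ is $$\mathcal{S}^{\odot}=(1+m)^{2}\mathcal{S}+m(m+1)|\mathcal{V}|^{2}-m|\mathcal{V}|.$$
   Context: For a connected finite graph $G$, its geodesic distance is $\mathcal{S}(G)=\sum_{\{u,v\}} d_G(u,v)$, the sum of the shortest-path distances over all unordered pairs of distinct vertices of $G$. The $m$-vertex-operation graph of a graph $G=(\mathcal{V},\mathcal{E})$ is obtained by attaching, to every vertex $u\in\mathcal{V}$, $m$ new pendant vertices, each joined by an edge to $u$ only (all new vertices distinct). *)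

(* Defs.v *)
From mathcomp Require Import all_boot all_order all_algebra.

Set Implicit Arguments.
Unset Strict Implicit.
Unset Printing Implicit Defensive.

Record sgraph := SGraph {
  vertex :> finType;
  adj : rel vertex;
  adj_sym : symmetric adj;
  adj_irrefl : irreflexive adj }.

Definition connected (G : sgraph) : Prop := forall x y : G, connect (@adj G) x y.

(* A cycle is a cyclic sequence of at least three distinct vertices; without
   the size bound the two ends of a single edge would form one. *)
Definition acyclic (G : sgraph) : Prop :=
  forall c : seq G, 2 < size c -> ~ ucycle (@adj G) c.

Definition is_tree (G : sgraph) : Prop :=
  [/\ 0 < #|G|, connected G & acyclic G].

Definition walk_of_length (G : sgraph) (x y : G) (n : nat) : bool :=
  [exists p : n.-tuple G, path (@adj G) x p && (last x p == y)].

Lemma connect_walk (G : sgraph) (x y : G) :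
  connect (@adj G) x y -> exists n, walk_of_length x y n.
Proof.
case/connectP=> p px ->; exists (size p).
by apply/existsP; exists (in_tuple p); rewrite px eqxx.
Qed.

(* The value 0 on disconnected pairs is a dummy. *)
Definition dist (G : sgraph) (x y : G) : nat :=
  if @idP (connect (@adj G) x y) is ReflectT xy then ex_minn (connect_walk xy)
  else 0.

Lemma dist_walk (G : sgraph) (x y : G) : connect (@adj G) x y ->
  exists2 p, path (@adj G) x p /\ last x p = y & size p = dist x y.
Proof.
rewrite /dist; case: {-}_ / idP => // xy _; case: ex_minnP => n + _.
by case/existsP=> p /andP[px /eqP py]; exists p; rewrite ?size_tuple.
Qed.

Lemma dist_min (G : sgraph) (x : G) (p : seq G) :
  path (@adj G) x p -> dist x (last x p) <= size p.
Proof.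
move=> px; rewrite /dist; case: {-}_ / idP => // xy.
case: ex_minnP => n _; apply.
by apply/existsP; exists (in_tuple p); rewrite px eqxx.
Qed.

(* Each unordered pair of distinct vertices is counted once, in the order given
   by the enumeration of the vertex type. *)
Definition geodesic_distance (G : sgraph) : nat :=
  \sum_(u : G) \sum_(v : G | enum_rank u < enum_rank v) dist u v.

(* [inr (u, i)] is the i-th pendant vertex attached to [u]. *)
Definition vertex_op_adj (G : sgraph) (m : nat) : rel (G + G * 'I_m)%type :=
  fun x y => match x, y with
  | inl u, inl v => adj u v
  | inl u, inr (v, _) => u == v
  | inr (u, _), inl v => u == v
  | inr _, inr _ => false
  end.

Lemma vertex_op_adj_sym (G : sgraph) (m : nat) : symmetric (@vertex_op_adj G m).
Proof. by case=> [u|[u i]] [v|[v j]] //=; rewrite adj_sym || rewrite eq_sym. Qed.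

Lemma vertex_op_adj_irrefl (G : sgraph) (m : nat) :
  irreflexive (@vertex_op_adj G m).
Proof. by case=> [u|[u i]] //=; rewrite adj_irrefl. Qed.

Definition vertex_op (G : sgraph) (m : nat) : sgraph :=
  SGraph (@vertex_op_adj_sym G m) (@vertex_op_adj_irrefl G m).

Lemma vertex_op_connected (G : sgraph) (m : nat) :
  connected G -> connected (vertex_op G m).
Proof.
move=> cG; set e := @adj (vertex_op G m).
have base u v : connect e (inl u) (inl v).
  case/connectP: (cG u v) => p + ->; elim: p u => [|w p IHp] u /=.
    by rewrite connect0.
  by case/andP=> uw /IHp; apply: connect_trans; apply: connect1.
case=> [u|[u i]] [v|[v j]].
- exact: base.
- by apply: connect_trans (base u v) (connect1 _); apply: eqxx.
- by apply: connect_trans (connect1 _) (base u v); apply: eqxx.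
- apply: (@connect_trans _ _ (inl u)); first by apply: connect1; apply: eqxx.
  by apply: connect_trans (base u v) (connect1 _); apply: eqxx.
Qed.

(* Main.v *)
Require Import Defs.
From mathcomp Require Import all_boot all_order all_algebra.
From mathcomp Require Import zify.
Import GRing.Theory.

(** Write [host x] for the vertex of [G] that [x] sits on and [pend x] for 1 or
    0 according to whether [x] is a new vertex. In a connected graph, distinct
    vertices [x], [y] of the vertex-operation graph are at distance
    [pend x + d (host x) (host y) + pend y], while on the diagonal this
    expression exceeds the true distance 0 by [2 * pend x]. Summing over all
    ordered pairs and halving gives the formula. *)

Lemma distxx {G : sgraph} (x : G) : dist x x = 0.
Proof. by apply/eqP; rewrite -leqn0; exact: (@dist_min G x [::]). Qed.

Lemma dist_triangle {G : sgraph} (y x z : G) :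
  connected G -> dist x z <= dist x y + dist y z.
Proof.
move=> cG; have [p [px py] <-] := dist_walk (cG x y).
have [q [qy qz] <-] := dist_walk (cG y z).
rewrite -size_cat -qz -py -last_cat; apply: dist_min.
by rewrite cat_path px py.
Qed.

Lemma dist_adj {G : sgraph} (x y : G) : adj x y -> dist x y <= 1.
Proof. by move=> xy; apply: (@dist_min G x [:: y]); rewrite /= xy. Qed.

Lemma dist_sym {G : sgraph} (x y : G) : connected G -> dist x y = dist y x.
Proof.
move=> cG; suff le (u v : G) : dist u v <= dist v u by apply/eqP; rewrite eqn_leq !le.
have [p [pv <-] <-] := dist_walk (cG v u); rewrite -(size_belast v p) -size_rev.
have {2}-> : v = last (last v p) (rev (belast v p)).
  by case: p {pv} => //= w p; rewrite rev_cons last_rcons.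
apply: dist_min; rewrite rev_path; apply: sub_path pv => a b /=.
by rewrite adj_sym.
Qed.

(** Exchanging the two summations in one copy of [geodesic_distance G] makes it range over the pairs
    in reverse order, by symmetry of [dist]. *)
Lemma sum_dist {G : sgraph} : connected G ->
  \sum_(u : G) \sum_(v : G) dist u v = 2 * geodesic_distance G.
Proof.
move=> cG; rewrite mul2n -addnn /geodesic_distance.
rewrite [X in _ = _ + X](exchange_big_dep predT) //= -big_split /=.
apply: eq_bigr => u _.
rewrite (bigID (fun v => enum_rank u < enum_rank v)) /=; congr (_ + _).
(* The complement of [enum_rank u < enum_rank v] still contains [v = u], whose term is 0. *)
rewrite (bigD1 u) ?ltnn //= distxx add0n.
apply: eq_big => [v|v _]; last exact: dist_sym.
rewrite -leqNgt [RHS]ltn_neqAle andbC; congr (~~ _ && _).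
by rewrite -(inj_eq enum_rank_inj).
Qed.

Section VertexOp.
Context {G : sgraph} {m : nat}.
Hypothesis cG : connected G.
Implicit Types x y : vertex_op G m.

Definition host x : G := match x with inl u => u | inr (u, _) => u end.

Definition pend x : nat := match x with inl _ => 0 | inr _ => 1 end.

(** This is the lower bound on distances, stated for arbitrary walks so that induction applies. An
    edge either joins two hosts or a pendant vertex to its own host, so it pays for only one unit of
    the left side. *)
Lemma dist_host_path x (p : seq (vertex_op G m)) :
  path (@adj (vertex_op G m)) x p -> x != last x p ->
  pend x + dist (host x) (host (last x p)) + pend (last x p) <= size p.
Proof.
elim: p x => [|z p IHp] x /=; first by rewrite eqxx.
case/andP=> xz /IHp{IHp}; set y := last z p => IHp xy.
have step : pend x + dist (host x) (host z) + pend z <= 1.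
  case: x z xz {IHp xy y} => [u|[u i]] [v|[v j]] //=.
  - by rewrite add0n addn0 => /dist_adj.
  - by move/eqP->; rewrite distxx.
  - by move/eqP->; rewrite distxx.
have tri := dist_triangle (host z) (host x) (host y) cG.
(* If the first step already reaches the endpoint, the induction hypothesis is void, but [step]
   alone suffices. *)
case: (eqVneq z y) IHp => [zy _|_ /(_ isT)]; last first.
  by rewrite -ltnS => IH; apply: leq_trans IH; clearbody y; lia.
by rewrite -zy; apply: leq_trans step _.
Qed.

Lemma dist_inl_host x :
  @dist (vertex_op G m) x (inl (host x)) <= pend x.
Proof.
case: x => [u|[u i]] /=; first by rewrite distxx.
by apply: dist_adj; apply: eqxx.
Qed.

Lemma dist_inl_le (u v : G) :
  @dist (vertex_op G m) (inl u) (inl v) <= dist u v.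
Proof.
have [p [pu <-] <-] := dist_walk (cG u v).
rewrite -(last_map inl) -(size_map (inl : G -> vertex_op G m)).
by apply: dist_min; rewrite path_map.
Qed.

(** The upper bound comes from the route through both hosts, the lower bound from applying
    [dist_host_path] to a shortest walk. *)
Lemma dist_vertex_op x y : x != y ->
  dist x y = pend x + dist (host x) (host y) + pend y.
Proof.
have cG' := @vertex_op_connected G m cG.
move=> xy; apply/eqP; rewrite eqn_leq; apply/andP; split.
  have := @dist_triangle (vertex_op G m) (inl (host x)) x y cG'.
  have := @dist_triangle (vertex_op G m) (inl (host y)) (inl (host x)) y cG'.
  have := dist_inl_host x; have := dist_inl_host y.
  rewrite (@dist_sym (vertex_op G m) y) //; have := dist_inl_le (host x) (host y); lia.
have [p [px py] <-] := dist_walk (cG' x y).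
by move: xy; rewrite -py; apply: dist_host_path.
Qed.

(** Every fibre of [host] consists of one old vertex and [m] pendant ones. *)
Lemma sum_host (F : G -> nat) :
  \sum_(x : vertex_op G m) F (host x) = m.+1 * \sum_(u : G) F u.
Proof.
rewrite big_sumType /= mulSn; congr (_ + _).
rewrite -(pair_big predT predT (fun u _ => F u)) /= big_distrr /=.
by apply: eq_bigr => u _; rewrite sum_nat_const card_ord.
Qed.

Lemma sum_pend : \sum_(x : vertex_op G m) pend x = m * #|G|.
Proof.
by rewrite big_sumType /= big1 // sum1_card card_prod card_ord mulnC.
Qed.

(* The correction term moved to the left avoids truncated subtraction. *)
Lemma geodesic_distance_vertex_op :
  geodesic_distance (vertex_op G m) + m * #|G| =
  m.+1 ^ 2 * geodesic_distance G + m * m.+1 * #|G| ^ 2.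
Proof.
have cardV : #|vertex_op G m| = m.+1 * #|G|.
  by rewrite card_sum card_prod card_ord mulSn mulnC.
have: \sum_(x : vertex_op G m) \sum_(y : vertex_op G m) dist x y
    + 2 * \sum_(x : vertex_op G m) pend x =
  \sum_(x : vertex_op G m) \sum_(y : vertex_op G m)
    (pend x + dist (host x) (host y) + pend y).
  rewrite big_distrr -big_split /=; apply: eq_bigr => x _.
  rewrite (bigD1 x) //= [RHS](bigD1 x) //= !distxx.
  rewrite add0n addn0 mul2n -addnn addnC; congr (_ + _).
  by apply: eq_bigr => y yx; rewrite dist_vertex_op // eq_sym.
(* Each of the two [pend] terms sums to [m * #|G|] times the order [m.+1 * #|G|] of the new graph;
   the middle term gains a factor [m.+1] from each of its two sums. *)
under [RHS]eq_bigr => x _.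
  rewrite !big_split /= sum_nat_const sum_pend sum_host; over.
rewrite !big_split /= -!big_distrr /= sum_nat_const sum_pend cardV.
rewrite (sum_host (fun u => \sum_(v : G) dist u v)) sum_dist //.
by rewrite (sum_dist (@vertex_op_connected G m cG)) -!mulnn; move: #|G| => n; lia.
Qed.

End VertexOp.

Local Open Scope ring_scope.

Theorem theorem2 (T : sgraph) (hT : is_tree T) (m : nat) (hm : (1 <= m)%N) :
  (geodesic_distance (vertex_op T m))%:Z =
    (1 + m%:Z) ^+ 2 * (geodesic_distance T)%:Z
    + m%:Z * (m%:Z + 1) * #|T|%:Z ^+ 2 - m%:Z * #|T|%:Z.
Proof.
have [_ cT _] := hT; have E := @geodesic_distance_vertex_op T m cT.
by lia.
Qed.
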